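(* Let $n\ge2$, $b\ge2$, $c>0$, and $r=\lceil\log_b(cn)\rceil$. Let $P^r_0$ denote the distribution on $\{0,\dots,n-1\}$ of the base-$b$ carries chain after $r$ steps started from $0$, and let $\pi(j)=A(n,j)/n!$ be its stationary distribution. Then $$\|P^r_0-\pi\|_{TV}\le\tfrac12\sqrt{e^{1/(2c^2)}-1}.$$
   Context: $A(n,j)$ is the number of permutations $\sigma\in S_n$ with exactly $j$ descents (a descent at $i$, $1\le i\le n-1$, means $\sigma(i+1)<\sigma(i)$). The base-$b$ carries chain for adding $n$ numbers is the Markov chain on $\{0,\dots,n-1\}$ given by $\kappa_0=0$, $\kappa_{t+1}=\lfloor(\kappa_t+X_{t+1,1}+\dots+X_{t+1,n})/b\rfloor$ with $X_{t,k}$ i.i.d. uniform on $\{0,\dots,b-1\}$. Total variation distance: $\|P-Q\|_{TV}=\frac12\sum_x|P(x)-Q(x)|$. *)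

(* Defs.v *)
From Stdlib Require Import Reals ZArith.
From mathcomp Require Import all_boot all_fingroup.

Set Implicit Arguments.
Unset Strict Implicit.
Unset Printing Implicit Defensive.

Definition descents (n : nat) (s : {perm 'I_n}) : nat :=
  #|[set i : 'I_n | (i.+1 < n) && (val (s (insubd i i.+1)) < val (s i))]|.

Definition eulerian (n j : nat) : nat :=
  #|[set s : {perm 'I_n} | descents s == j]|.

(* Carry after r steps of the base-b carries chain for adding n numbers,
   started at kappa_0 = 0, driven by the digits X t k (t < r, k < n):
   kappa_{t+1} = (kappa_t + sum_k X t k) / b. *)
Definition carry_after (b n r : nat) (X : {ffun 'I_r -> {ffun 'I_n -> 'I_b}}) : nat :=
  foldl (fun kap (t : 'I_r) => (kap + \sum_(k < n) val (X t k)) %/ b) 0 (enum 'I_r).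

Definition carries_count (b n r j : nat) : nat :=
  #|[set X : {ffun 'I_r -> {ffun 'I_n -> 'I_b}} | carry_after X == j]|.

(* P^r_0(j): law of kappa_r when the X t k are i.i.d. uniform on {0,...,b-1}. *)
Definition carries_dist (b n r j : nat) : R :=
  Rdiv (INR (carries_count b n r j)) (INR (b ^ (r * n))).

Definition carries_stat (n j : nat) : R :=
  Rdiv (INR (eulerian n j)) (INR (n `!)).

Fixpoint Rsum (f : nat -> R) (m : nat) : R :=
  match m with
  | 0 => R0
  | m'.+1 => Rplus (Rsum f m') (f m')
  end.

Definition tv_dist (n : nat) (P Q : nat -> R) : R :=
  Rmult (Rinv (IZR 2)) (Rsum (fun j => Rabs (Rminus (P j) (Q j))) n).

(* Main.v *)
(** With a = b^r, the carry after r steps has the law of the quotient by a of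
    S, the sum of n independent uniform digits in base a.  If m is the carry of
    an independent addition in base K, then the quotient of m + S by a has the
    law of the carry in base K a, so the two carry laws differ in l1 norm by at
    most twice E[m] <= (n-1)/2 times the l1 distance between the laws of S and
    S + 1.  As the law of S is symmetric and unimodal, this distance is twice
    its largest value.  That value is at most 1/a, and at most
    (2a^2+1)/(3a^3) for n >= 4.

    As K grows, the carry law in base K a tends to pi: carries in base N are
    descents of a uniform word of length n over N letters (the digits added are
    the successive differences of the word modulo N), and a word without
    repetition has the descents of a uniform permutation.

    Finally c n <= a, so e^(1/(2c^2)) - 1 >= e^x - 1 with x = n^2/(2a^2), which
    is at least x, and at least 4 when x >= 2 (covering a = 1, and a = 2 with
    n >= 4, where the total variation distance is bounded by 1). *)

Require Import Defs.
From Stdlib Require Import Reals ZArith Lra.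
From mathcomp Require Import all_boot all_fingroup.
From mathcomp Require Import zify.

Set Implicit Arguments.
Unset Strict Implicit.
Unset Printing Implicit Defensive.

Local Open Scope R_scope.

(** * Real estimates with exponential and logarithm *)

Lemma exp2_ge5 : 5 <= exp 2.
Proof.
replace 2 with (/ 2 + / 2 + (/ 2 + / 2)) by field; rewrite !exp_plus.
(* The fourth power of this bound gives 81/16, whereas [1 + 2 <= exp 2] would be too weak. *)
have h : 1 + / 2 <= exp (/ 2) by apply: exp_ineq1_le.
move: (exp (/ 2)) h => e h; have {}h : 9 / 4 <= e * e by nra.
by move: (e * e) h => e2 h; nra.
Qed.

(** [T] stands for the l1 distance. In each case either [x >= 2] and [T <= 2] is enough, or a
    sharper bound on [T] gives [T ^ 2 <= x]. *)
Lemma exp_quadratic_bound (n a : nat) (T : R) :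
  (2 <= n)%nat -> (1 <= a)%nat -> 0 <= T -> T <= 2 ->
  T * INR a <= INR n - 1 ->
  ((4 <= n)%nat ->
     T * (3 * INR a ^ 3) <= (INR n - 1) * (2 * INR a ^ 2 + 1)) ->
  T ^ 2 <= exp (INR n ^ 2 / (2 * INR a ^ 2)) - 1.
Proof.
move=> n2 a1 T0 T2 Ta Ta4; set x := INR n ^ 2 / _.
have a1R : 1 <= INR a by rewrite INR_IZR_INZ; apply: IZR_le; lia.
have xE : x * (2 * INR a ^ 2) = INR n ^ 2 by rewrite /x; field; lra.
have n2R : 2 <= INR n by rewrite INR_IZR_INZ; apply: IZR_le; lia.
have x0 : 0 <= x by nra.
have ex : 1 + x <= exp x := exp_ineq1_le x.
have large : 2 <= x -> T ^ 2 <= exp x - 1.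
  move=> le2x; have := exp2_ge5.
  have [lt2x|<-] := Rle_lt_or_eq _ _ le2x; last by nra.
  by have := exp_increasing _ _ lt2x; nra.
have small : T ^ 2 * (2 * INR a ^ 2) <= INR n ^ 2 -> T ^ 2 <= exp x - 1.
  rewrite -xE => le_T; have : T ^ 2 <= x; last by lra.
  by apply: Rmult_le_reg_r le_T; nra.
have [a_eq1|a_ge2] : a = 1%nat \/ (2 <= a)%nat by lia.
  by apply: large; rewrite a_eq1 /= in xE; nra.
(* The bound [(n - 1) / a] is good enough as long as [2 * (n - 1) ^ 2 <= n ^ 2], that is for
   [n <= 3]. *)
have [n_le3|n_ge4] : (n <= 3)%nat \/ (4 <= n)%nat by lia.
  apply: small.
  have n3R : INR n <= 3 by rewrite INR_IZR_INZ; apply: IZR_le; lia.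
  have : (T * INR a) ^ 2 <= (INR n - 1) ^ 2 by apply: pow_incr; nra.
  by rewrite Rpow_mult_distr; nra.
have n4R : 4 <= INR n by rewrite INR_IZR_INZ; apply: IZR_le; lia.
have [a_eq2|a_ge3] : a = 2%nat \/ (3 <= a)%nat by lia.
  by apply: large; rewrite a_eq2 /= in xE; nra.
have a3R : 3 <= INR a by rewrite INR_IZR_INZ; apply: IZR_le; lia.
apply: small; move: (Ta4 n_ge4) => {Ta4}.
move: (INR a) (INR n) a3R n4R T0 => A N A3 N4 T0 le_T.
(* With [B = A ^ 2] this is tight: at [B = 9] it reads 722 <= 729 after division by 9 ^ 0 = 1 on the
   left and with [9 * B ^ 2 = 729] on the right; it fails at [B = 4], hence the separate case
   [a = 2]. *)
have le_q : 2 * (2 * A ^ 2 + 1) ^ 2 <= 9 * A ^ 4.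
  have : 9 <= A ^ 2 by nra.
  by rewrite (_ : A ^ 4 = A ^ 2 * A ^ 2); [move: (A ^ 2) => B; nra | ring].
have A3_gt0 : 0 < A ^ 3 by apply: pow_lt; lra.
have : (T * (3 * A ^ 3)) ^ 2 <= ((N - 1) * (2 * A ^ 2 + 1)) ^ 2.
  by apply: pow_incr; nra.
rewrite !Rpow_mult_distr => le_sq.
have N_sq : (N - 1) ^ 2 <= N ^ 2 by nra.
have A4_gt0 : 0 < A ^ 4 by apply: pow_lt; lra.
apply: (Rmult_le_reg_r (9 * A ^ 4)); first lra.
apply: (Rle_trans _ (2 * ((N - 1) ^ 2 * (2 * A ^ 2 + 1) ^ 2))).
  by apply: Rle_trans (Rmult_le_compat_l 2 _ _ _ le_sq); [right; ring | lra].
have := Rmult_le_compat_l _ _ _ (pow2_ge_0 (N - 1)) le_q.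
have : (N - 1) ^ 2 * (9 * A ^ 4) <= N ^ 2 * (9 * A ^ 4).
  by apply: Rmult_le_compat_r => //; lra.
by lra.
Qed.

Lemma ceil_log_pow (y : R) (b : nat) (r : Z) : (2 <= b)%nat -> 0 < y ->
  ln y / ln (INR b) <= IZR r -> y <= INR b ^ Z.to_nat r.
Proof.
move=> b2 y0 le_r.
have b2R : 2 <= INR b by rewrite INR_IZR_INZ; apply: IZR_le; lia.
have lnb : 0 < ln (INR b) by rewrite -ln_1; apply: ln_increasing; lra.
(* [Z.to_nat] replaces a negative [r] by 0, which only weakens this upper bound. *)
have le_k : ln y / ln (INR b) <= INR (Z.to_nat r).
  by apply: Rle_trans le_r _; rewrite INR_IZR_INZ; apply: IZR_le; lia.
have {}le_k : ln y <= INR (Z.to_nat r) * ln (INR b).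
  rewrite (_ : ln y = ln y / ln (INR b) * ln (INR b)); last by field; lra.
  by apply: Rmult_le_compat_r le_k; lra.
rewrite -Rpower_pow; last lra.
rewrite -{1}(exp_ln _ y0) /Rpower.
have [lt_k|->] := Rle_lt_or_eq _ _ le_k; last by right.
by left; apply: exp_increasing.
Qed.

Lemma tv_exp_bound (n a : nat) (c T : R) : (2 <= n)%nat -> 0 < c ->
  c * INR n <= INR a ->
  T ^ 2 <= exp (INR n ^ 2 / (2 * INR a ^ 2)) - 1 ->
  / 2 * T <= / 2 * sqrt (exp (/ (2 * c ^ 2)) - 1).
Proof.
move=> n2 c0 le_a le_T; apply: Rmult_le_compat_l; first lra.
have n2R : 2 <= INR n by rewrite INR_IZR_INZ; apply: IZR_le; lia.
apply: Rle_trans (Rle_abs T) _; rewrite -sqrt_Rsqr_abs; apply: sqrt_le_1_alt.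
rewrite Rsqr_pow2; apply: Rle_trans le_T _; apply: Rplus_le_compat_r.
have a0 : 0 < INR a by nra.
have le_x : INR n ^ 2 / (2 * INR a ^ 2) <= / (2 * c ^ 2).
  apply: (Rmult_le_reg_r (2 * INR a ^ 2 * c ^ 2)).
    by have := pow_lt _ 2 a0; have := pow_lt _ 2 c0; nra.
  rewrite (_ : _ / _ * _ = (c * INR n) ^ 2); last by field; lra.
  rewrite (_ : / _ * _ = INR a ^ 2); last by field; lra.
  by apply: pow_incr; nra.
have [lt_x|->] := Rle_lt_or_eq _ _ le_x; last by right.
by left; apply: exp_increasing.
Qed.

From mathcomp Require Import all_order all_algebra.
From mathcomp Require Import ring lra.
From mathcomp Require Import Rstruct.

Import Order.TTheory GRing.Theory Num.Theory.
Local Close Scope R_scope.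
Local Open Scope ring_scope.

(** * Generating polynomials of digit sums *)

Lemma bounded_fun (T : finType) (phi : T -> nat) :
  exists B, forall x, (phi x < B)%N.
Proof.
exists (\max_x phi x).+1 => x; rewrite ltnS; exact: leq_bigmax.
Qed.

Lemma sum_coef_genfun (R : comNzRingType) (T : finType) (phi : T -> nat)
    (F : nat -> R) (B : nat) (ltB : forall x, (phi x < B)%N) :
  \sum_x F (phi x) = \sum_(s < B) (\sum_x 'X^(phi x) : {poly R})`_s * F s.
Proof.
under [RHS]eq_bigr => s _ do rewrite coef_sum mulr_suml.
rewrite exchange_big; apply: eq_bigr => x _ /=.
rewrite (bigD1 (Ordinal (ltB x))) //= coefXn eqxx mul1r big1 ?addr0 // => s.
rewrite -val_eqE coefXn /= => /negbTE ->; exact: mul0r.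
Qed.

(** The coefficients count how often each value is taken, so a polynomial identity identifies two
    distributions without a bijection between [T] and [T']. *)
Lemma eq_sum_genfun (R : comNzRingType) (T T' : finType)
    (phi : T -> nat) (psi : T' -> nat) (F : nat -> R) :
  \sum_x 'X^(phi x) = \sum_y 'X^(psi y) :> {poly R} ->
  \sum_x F (phi x) = \sum_y F (psi y).
Proof.
move=> eq_gf; have [B ltB] := bounded_fun phi.
have [B' ltB'] := bounded_fun psi.
rewrite (@sum_coef_genfun _ _ _ _ (maxn B B')) => [|x]; last first.
  by rewrite leq_max ltB.
rewrite (@sum_coef_genfun _ _ psi _ (maxn B B')) => [|x]; last first.
  by rewrite leq_max ltB' orbT.
by rewrite eq_gf.
Qed.

Lemma genfun_ffun (R : comNzRingType) (I J : finType) (g : I -> J -> nat) :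
  \sum_(f : {ffun I -> J}) 'X^(\sum_i g i (f i)) =
  \prod_i \sum_j 'X^(g i j) :> {poly R}.
Proof.
rewrite bigA_distr_bigA; apply: eq_bigr => f _.
by elim/big_rec2: _ => [|i y1 y2 _ <-]; rewrite ?expr0 ?exprD.
Qed.

Definition box_poly (R : comNzRingType) (a : nat) : {poly R} :=
  \sum_(i < a) 'X^i.

Lemma genfun_box (R : comNzRingType) (a n : nat) :
  \sum_(Y : {ffun 'I_n -> 'I_a}) 'X^(\sum_k Y k) = box_poly R a ^+ n.
Proof.
rewrite (genfun_ffun R (fun (_ : 'I_n) (i : 'I_a) => i : nat)).
by rewrite prodr_const card_ord.
Qed.

(** Both sides times [X - 1] equal [X ^ (K * a) - 1]. In terms of digits, a base [K * a] digit is a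
    base [K] digit plus [K] times a base [a] digit. *)
Lemma box_polyM (R : idomainType) (K a : nat) :
  box_poly R (K * a) = box_poly R K * \sum_(i < a) 'X^(K * i).
Proof.
have X1_neq0 : 'X - 1 != 0 :> {poly R} by rewrite polyXsubC_eq0.
apply: (mulfI X1_neq0).
have geom (x : {poly R}) m : (x - 1) * \sum_(i < m) x ^+ i = x ^+ m - 1.
  by rewrite -subrX1.
rewrite mulrA !geom exprM -geom.
by congr (_ * _); apply: eq_bigr => i _; rewrite exprM.
Qed.

Lemma box_poly_digits (R : idomainType) (b r : nat) :
  \prod_(t < r) \sum_(i < b) 'X^(b ^ t * i) = box_poly R (b ^ r).
Proof.
elim: r => [|r IHr]; first by rewrite big_ord0 /box_poly big_ord1.
by rewrite big_ord_recr /= IHr expnSr box_polyM.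
Qed.

(** * From [r] steps in base [b] to one addition in base [b ^ r] *)

Local Open Scope nat_scope.

(** Nested floor divisions by [b] merge into a single one, so the intermediate carries disappear. *)
Lemma foldl_carry (b kap : nat) (s : seq nat) (b_gt0 : (0 < b)%N) :
  foldl (fun k d => (k + d) %/ b)%N kap s =
  ((kap + \sum_(t < size s) b ^ t * nth 0 s t) %/ b ^ size s)%N.
Proof.
elim: s kap => [|d s IHs] kap /=; first by rewrite big_ord0 addn0 divn1.
rewrite IHs big_ord_recl /= expn0 mul1n expnS divnMA; congr (_ %/ _)%N.
have -> : \sum_(i < size s) b ^ bump 0 i * nth 0%N s i =
          (\sum_(i < size s) b ^ i * nth 0%N s i) * b.
  rewrite big_distrl /=; apply: eq_bigr => i _.
  by rewrite /bump leq0n add1n expnSr mulnAC.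
by rewrite addnA [in RHS]addnC divnMDl // addnC.
Qed.

Lemma carry_afterE (b n r : nat) (X : {ffun 'I_r -> {ffun 'I_n -> 'I_b}}) :
  (0 < b)%N ->
  carry_after X = ((\sum_(t < r) \sum_(k < n) b ^ t * X t k) %/ b ^ r)%N.
Proof.
move=> b_gt0; pose D t := (\sum_(k < n) X t k)%N.
have foldE ts kap :
    foldl (fun kap (t : 'I_r) => (kap + \sum_(k < n) val (X t k)) %/ b) kap ts =
    foldl (fun k d => (k + d) %/ b) kap (map D ts).
  by elim: ts kap => //= t ts IHts kap; rewrite IHts.
rewrite /carry_after foldE.
rewrite foldl_carry // size_map size_enum_ord add0n; congr (_ %/ _)%N.
apply: eq_bigr => t _; rewrite -big_distrr /=; congr (_ * _)%N.
by rewrite (nth_map t) ?size_enum_ord // nth_ord_enum.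
Qed.

Local Open Scope ring_scope.

(** For fixed [k], the digits [X t k] are the base [b] expansion of one uniform digit in base
    [b ^ r]. *)
Lemma sum_carry_after (b n r : nat) (F : nat -> rat) (b_gt0 : (0 < b)%N) :
  \sum_(X : {ffun 'I_r -> {ffun 'I_n -> 'I_b}}) F (carry_after X) =
  \sum_(Y : {ffun 'I_n -> 'I_(b ^ r)}) F ((\sum_k Y k) %/ b ^ r)%N.
Proof.
under eq_bigr => X _ do rewrite carry_afterE //.
apply: (@eq_sum_genfun _ _ _ (fun X : {ffun 'I_r -> {ffun 'I_n -> 'I_b}} =>
  \sum_(t < r) \sum_(k < n) b ^ t * X t k)%N
  (fun Y : {ffun 'I_n -> 'I_(b ^ r)} =>
  \sum_k Y k)%N (fun s => F (s %/ b ^ r)%N)).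
rewrite genfun_box -box_poly_digits -prodrXl.
rewrite (genfun_ffun _ (fun (t : 'I_r) (x : {ffun 'I_n -> 'I_b}) =>
  \sum_(k < n) b ^ t * x k)%N).
apply: eq_bigr => t _.
rewrite (genfun_ffun _ (fun (_ : 'I_n) (i : 'I_b) => b ^ t * i)%N).
by rewrite prodr_const card_ord.
Qed.

(** Each digit splits into a low digit [u k] and a high digit [v k]; the carry of the low part will
    be the one fed into the addition in base [a]. *)
Lemma sum_box_mul (n K a : nat) (F : nat -> rat) :
  \sum_(Y : {ffun 'I_n -> 'I_(K * a)}) F (\sum_k Y k)%N =
  \sum_(u : {ffun 'I_n -> 'I_K}) \sum_(v : {ffun 'I_n -> 'I_a})
    F (\sum_(k < n) u k + K * \sum_(k < n) v k)%N.
Proof.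
rewrite pair_big /=; apply: (@eq_sum_genfun _ _ _
  (fun Y : {ffun 'I_n -> 'I_(K * a)} => \sum_k Y k)%N
  (fun uv : {ffun 'I_n -> 'I_K} * {ffun 'I_n -> 'I_a} =>
   \sum_(k < n) uv.1 k + K * \sum_(k < n) uv.2 k)%N).
rewrite genfun_box box_polyM exprMn -genfun_box.
under [RHS]eq_bigr => uv _ do rewrite exprD.
rewrite -(pair_big xpredT xpredT (fun (u : {ffun 'I_n -> 'I_K})
  (v : {ffun 'I_n -> 'I_a}) => 'X^(\sum_k u k) * 'X^(K * \sum_k v k))) /=.
rewrite big_distrl /=.
apply: eq_bigr => u _; rewrite -big_distrr /=; congr (_ * _).
under [RHS]eq_bigr => v _ do rewrite big_distrr /=.
rewrite (genfun_ffun _ (fun (_ : 'I_n) (i : 'I_a) => K * i)%N).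
by rewrite prodr_const card_ord.
Qed.

(** * Counts of words by digit sum: unimodality and largest value *)

(** Extending the counts by 0 to negative integers frees shifts and reflections of [s] from side
    conditions. *)
Definition box_count (a n : nat) (s : int) : rat :=
  if s is Posz k then (box_poly rat a ^+ n)`_k else 0.

Lemma box_countN (a n : nat) (s : int) : s < 0 -> box_count a n s = 0.
Proof. by case: s. Qed.

Lemma box_count0 (a : nat) (s : int) : box_count a 0 s = (s == 0)%:R.
Proof. by case: s => [[|k]|k]; rewrite /= ?expr0 ?coef1. Qed.

Lemma box_countS (a n : nat) (s : int) :
  box_count a n.+1 s = \sum_(i < a) box_count a n (s - i%:Z).
Proof.
case: s => k; last by rewrite big1 // => i _; apply: box_countN; lia.
rewrite /= exprSr /box_poly mulr_sumr coef_sum; apply: eq_bigr => i _.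
rewrite coefMXn; case: ltnP => le_ki; first by rewrite box_countN //; lia.
by rewrite subzn.
Qed.

Arguments box_count : simpl never.

Lemma box_count_ge0 (a n : nat) (s : int) : 0 <= box_count a n s.
Proof.
elim: n s => [|n IHn] s; first by rewrite box_count0.
by rewrite box_countS sumr_ge0.
Qed.

(** The two windows of length [a] overlap in all but their end terms. *)
Lemma box_countSB (a n : nat) (s : int) :
  box_count a n.+1 s - box_count a n.+1 (s - 1) =
  box_count a n s - box_count a n (s - a%:Z).
Proof.
rewrite !box_countS; move: (box_count a n) => f.
elim: a => [|a IHa]; first by rewrite !big_ord0 !subr0 !subrr.
rewrite !big_ord_recr /= opprD addrACA IHa.
rewrite (_ : s - 1 - a%:Z = s - a.+1%:Z); last by lia.
by rewrite addrA addrNK.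
Qed.

(** The distance to the centre [M / 2] is doubled to stay in [int]. Equal distances force equal
    values, so symmetry is included. *)
Definition sym_unimodal (M : int) (f : int -> rat) : Prop :=
  forall s t : int, `|s *+ 2 - M| <= `|t *+ 2 - M| -> f t <= f s.

Lemma sym_unimodal_box (a n : nat) (a_gt0 : (0 < a)%N) :
  sym_unimodal (n * a.-1)%:Z (box_count a n).
Proof.
elim: n => [|n IHn] s t.
  rewrite !box_count0; case: (t =P 0) => [->|_ _]; last by rewrite ler0n.
  by case: eqP => // s_neq0; lia.
set M := (n * a.-1)%:Z in IHn; set M' := (n.+1 * a.-1)%:Z.
have M'E : M' = M + a%:Z - 1 by rewrite /M /M'; lia.
have symf u : box_count a n (M - u) = box_count a n u.
  by apply/le_anti/andP; split; apply: IHn; lia.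
have symg u : box_count a n.+1 (M' - u) = box_count a n.+1 u.
  rewrite !box_countS (reindex_inj rev_ord_inj) /=; apply: eq_bigr => i _.
  by rewrite -symf; congr box_count; have := ltn_ord i; lia.
(* As [M' + 1 = M + a], such a [u] is at least as close to [M / 2] as [u - a], so the increments up
   to [u] are nonnegative by induction on [n]. *)
have incr (d : nat) u : u *+ 2 <= M' + 1 ->
    box_count a n.+1 (u - d%:Z) <= box_count a n.+1 u.
  move=> le_u; elim: d => [|d]; first by rewrite subr0.
  apply: le_trans; rewrite -subr_ge0.
  rewrite (_ : u - d.+1%:Z = u - d%:Z - 1); last by lia.
  by rewrite box_countSB subr_ge0; apply: IHn; lia.
have low u v : u *+ 2 <= M' -> v <= u ->
    box_count a n.+1 v <= box_count a n.+1 u.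
  move=> le_u le_vu; rewrite (_ : v = u - `|u - v|%N%:Z); last by lia.
  by apply: incr; lia.
have [les|gts] := leP (s *+ 2) M'; have [let_|gtt] := leP (t *+ 2) M' => le_st.
- by apply: low; lia.
- by rewrite -(symg t); apply: low; lia.
- by rewrite -(symg s); apply: low; lia.
- by rewrite -(symg s) -(symg t); apply: low; lia.
Qed.

(** The increments are nonnegative up to the centre and nonpositive after it. Both stretches
    telescope, and each costs at most [c]. *)
Lemma sum_dist_sym_unimodal (M : nat) (f : int -> rat) (B : nat) (c : rat) :
  sym_unimodal M%:Z f -> (forall s, 0 <= f s <= c) -> f (-1) = 0 ->
  \sum_(s < B) `|f s%:Z - f (s%:Z - 1)| <= c *+ 2.
Proof.
move=> unif fc f1.
have up m : (m * 2 <= M.+2)%N ->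
    \sum_(s < m) `|f s%:Z - f (s%:Z - 1)| <= f (m%:Z - 1).
  elim: m => [|m IHm] le_m; first by rewrite big_ord0 f1.
  rewrite big_ord_recr /= ger0_norm; last by rewrite subr_ge0 unif //; lia.
  rewrite (_ : m.+1%:Z - 1 = m%:Z); last by lia.
  have /IHm le_IH : (m * 2 <= M.+2)%N by lia.
  by lra.
have down m : \sum_(s < m) `|f s%:Z - f (s%:Z - 1)| <= c *+ 2 - f (m%:Z - 1).
  elim: m => [|m IHm].
    rewrite big_ord0 f1 subr0; have /andP[f0 fle] := fc 0; lra.
  have [le_m|gt_m] := leqP (m.+1 * 2)%N M.+2.
    apply: le_trans (up _ le_m) _.
    have /andP[_ ?] := fc (m.+1%:Z - 1); lra.
  rewrite big_ord_recr /= ler0_norm; last by rewrite subr_le0 unif //; lia.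
  by rewrite (_ : m.+1%:Z - 1 = m%:Z); [lra | lia].
by apply: le_trans (down B) _; have /andP[] := fc (B%:Z - 1); lra.
Qed.

Lemma sum_ord_lt (a n : nat) (Y : {ffun 'I_n -> 'I_a}) (B : nat) :
  (n * a.-1 < B)%N -> (\sum_k Y k < B)%N.
Proof.
apply: leq_ltn_trans; rewrite -[X in (_ <= X * _)%N]card_ord -sum_nat_const.
by apply: leq_sum => k _; have := ltn_ord (Y k); lia.
Qed.

Lemma sum_box_count (a n B : nat) : (n * a.-1 < B)%N ->
  \sum_(s < B) box_count a n s%:Z = (a ^ n)%:R.
Proof.
move=> lt_B; have := @sum_coef_genfun rat _
  (fun Y : {ffun 'I_n -> 'I_a} => \sum_k Y k)%N (fun=> 1) B
  (fun Y => sum_ord_lt Y lt_B).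
rewrite genfun_box sumr_const card_ffun !card_ord => ->.
by apply: eq_bigr => s _; rewrite mulr1.
Qed.

(** A bound relative to the number [a ^ n] of words survives the addition of a digit, so it suffices
    to start from a small [n]. *)
Lemma box_count_leS (a n : nat) (c : rat) :
  (forall s, box_count a n s <= c) -> forall s, box_count a n.+1 s <= a%:R * c.
Proof.
move=> le_c s; rewrite box_countS.
apply: le_trans (ler_sum _ (fun i _ => le_c _)) _.
by rewrite sumr_const card_ord mulr_natl.
Qed.

(** Below [a] the upper limit on the digits is not felt: this is stars and bars. *)
Lemma box_count_low (a n k : nat) : (k < a)%N ->
  box_count a n.+1 k%:Z = 'C(n + k, n)%:R.
Proof.
elim: n k => [|n IHn] k lt_ka.
  rewrite box_countS (bigD1 (Ordinal lt_ka)) //= box_count0 subrr eqxx.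
  rewrite big1 ?addr0 ?bin0 // => i; rewrite -val_eqE /= box_count0 => ne_ik.
  by case: eqP => // ?; lia.
elim: k lt_ka => [|k IHk] lt_ka.
  rewrite addn0 binn box_countS (bigD1 (Ordinal lt_ka)) /= //.
  rewrite subrr IHn // addn0 binn big1 ?addr0 // => i.
  rewrite -val_eqE /= => ne_i0.
  by rewrite box_countN //; lia.
(* The sliding-window relation loses its last term here and becomes Pascal's rule. *)
have := box_countSB a n.+1 k.+1%:Z.
rewrite (_ : k.+1%:Z - 1 = k%:Z); last by lia.
rewrite IHk; last by lia.
rewrite IHn // (@box_countN _ _ (_ - _)) ?subr0; last by lia.
move=> /eqP; rewrite subr_eq => /eqP ->; rewrite -natrD.
by congr _%:R; rewrite -addSnnS (addnS _.+1) binS addnC addSnnS.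
Qed.

Lemma box_count_le (a n : nat) (s : int) : box_count a n.+1 s <= (a ^ n)%:R.
Proof.
elim: n s => [|n IHn] s; last first.
  by apply: le_trans (box_count_leS IHn s) _; rewrite -natrM -expnS.
case: s => k; last by rewrite box_countN // ler0n.
have [lt_ka|le_ak] := ltnP k a; first by rewrite box_count_low // bin0.
rewrite box_countS big1 ?ler0n // => i _; rewrite box_count0.
by case: eqP => // ?; have := ltn_ord i; lia.
Qed.

(** The bound is the central value: the total [a ^ 3] minus the two outer windows,
    [2 * 'C(a.+1, 3)]. *)
Lemma box_count4_le (a : nat) (s : int) : (0 < a)%N ->
  box_count a 4 s <= (2 * a ^ 3 + a)%:R / 3.
Proof.
case: a => // a _.
have /le_trans : box_count a.+1 4 s <= box_count a.+1 4 (2 * a)%:Z.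
  by apply: sym_unimodal_box => //; lia.
apply.
have low : box_count a.+1 4 (a%:Z - 1) = 'C(a.+2, 3)%:R.
  case: a => [|a]; first by rewrite box_countN.
  rewrite (_ : a.+1%:Z - 1 = a%:Z); last by lia.
  by rewrite box_count_low ?addSn //; lia.
have high : box_count a.+1 4 (3 * a + 1)%:Z = 'C(a.+2, 3)%:R.
  by rewrite -low; apply/le_anti/andP; split; apply: sym_unimodal_box; lia.
(* The window of 3a+3 consecutive indices splits into three windows of length
   a+1; the outer two are equal by symmetry and lie in the binomial range. *)
have split3 : \sum_(0 <= i < (3 * a).+3)
    box_count a.+1 3 ((3 * a + 1)%:Z - i%:Z) =
    box_count a.+1 4 (3 * a + 1)%:Z + box_count a.+1 4 (2 * a)%:Z +
    box_count a.+1 4 (a%:Z - 1).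
  rewrite (big_cat_nat (n := (2 * a).+2)) //=; [|lia].
  rewrite (big_cat_nat (n := a.+1)) //=; [|lia].
  rewrite !box_countS; congr (_ + _ + _).
  - by rewrite big_mkord.
  - rewrite -{1}[a.+1]add0n big_addn.
    rewrite (_ : (2 * a).+2 - a.+1 = a.+1)%N ?big_mkord; last by lia.
    by apply: eq_bigr => i _; congr box_count; lia.
  - rewrite -{1}[(2 * a).+2]add0n big_addn.
    rewrite (_ : (3 * a).+3 - (2 * a).+2 = a.+1)%N ?big_mkord; last by lia.
    by apply: eq_bigr => i _; congr box_count; lia.
have := @sum_box_count a.+1 3 (3 * a).+2 ltac:(lia).
rewrite (reindex_inj rev_ord_inj) /=.
have -> : \sum_(j < (3 * a).+2) box_count a.+1 3 ((3 * a).+2 - j.+1)%N%:Z =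
  \sum_(0 <= i < (3 * a).+3) box_count a.+1 3 ((3 * a + 1)%:Z - i%:Z).
  (* The split window has one index more than the sum on the left; its last term lies at -1 and
     vanishes. *)
  rewrite big_nat_recr //= [X in _ = _ + X]box_countN ?addr0; last by lia.
  rewrite big_mkord; apply: eq_bigr => i _; congr box_count.
  by have := ltn_ord i; lia.
rewrite split3 low high => total.
have bin3 : ('C(a.+2, 3) * 6 = a.+2 * a.+1 * a)%N.
  by rewrite (bin_ffact _ 3) !ffactnS ffactn0 muln1 /= mulnA.
have {}bin3 : 'C(a.+2, 3)%:R * 6 = (a%:R + 2) * (a%:R + 1) * a%:R :> rat.
  have -> : a%:R + 2 = a.+2%:R :> rat by rewrite -[a.+2]addn2 natrD.
  have -> : a%:R + 1 = a.+1%:R :> rat by rewrite -[a.+1]addn1 natrD.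
  by rewrite -!natrM bin3.
have Sa : a.+1%:R = a%:R + 1 :> rat by rewrite -[a.+1]addn1 natrD.
move: total; rewrite natrD natrM !natrX Sa => total.
by move: bin3; lra.
Qed.

Lemma box_count_le4 (a n : nat) (s : int) : (0 < a)%N -> (4 <= n)%N ->
  box_count a n s <= (a ^ (n - 4) * (2 * a ^ 3 + a))%:R / 3.
Proof.
move=> a_gt0 le4n; rewrite -(subnK le4n) addnK; move: (n - 4)%N => m.
elim: m s => [|m IHm] s; first by rewrite expn0 mul1n box_count4_le.
rewrite addSn; apply: le_trans (box_count_leS IHm s) _.
by rewrite mulrA -natrM mulnA -expnS.
Qed.

(** * Carries as descents of words, and words as permutations *)

Definition word_descents (n N : nat) (y : {ffun 'I_n -> 'I_N}) : nat :=
  #|[set i : 'I_n | (i.+1 < n)%N && (y (insubd i i.+1) < y i)%N]|.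

Lemma word_descentsE (n N : nat) (y : {ffun 'I_n.+1 -> 'I_N}) :
  word_descents y =
  (\sum_(i < n) (y (lift ord0 i) < y (widen_ord (leqnSn n) i)))%N.
Proof.
rewrite /word_descents -sum1_card big_mkcond /= big_ord_recr /= inE ltnn addn0.
apply: eq_bigr => i _; rewrite inE /= ltnS ltn_ord /=.
rewrite (_ : insubd _ _ = lift ord0 i); first by case: (_ < _)%N.
by apply: val_inj; rewrite /= insubdK //= -topredE /= ltnS.
Qed.

(** The term [(y i < p) * N] is a borrow that makes the truncated subtraction exact. The result is
    below [N], so the default [p] of [insubd] is never taken. *)
Definition diff_word (n N : nat) (y : {ffun 'I_n.+1 -> 'I_N}) :
    {ffun 'I_n.+1 -> 'I_N} :=
  [ffun i => if unlift ord0 i is Some j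
             then let p := y (widen_ord (leqnSn n) j) in
                  insubd p (y i + (y i < p) * N - p)%N
             else y i].

Lemma diff_word0 (n N : nat) (y : {ffun 'I_n.+1 -> 'I_N}) :
  diff_word y ord0 = y ord0.
Proof. by rewrite ffunE unlift_none. Qed.

Lemma diff_wordS (n N : nat) (y : {ffun 'I_n.+1 -> 'I_N}) (i : 'I_n) :
  (diff_word y (lift ord0 i) + y (widen_ord (leqnSn n) i) =
   y (lift ord0 i) + (y (lift ord0 i) < y (widen_ord (leqnSn n) i)) * N)%N.
Proof.
rewrite ffunE liftK /=; set p := y (widen_ord _ _); set q := y (lift _ _).
rewrite insubdK.
  by case: ltnP => [|le_pq] /=; rewrite subnK //; have := ltn_ord p; lia.
rewrite -topredE /=; case: ltnP => [lt_qp|le_pq] /=;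
by have := ltn_ord p; have := ltn_ord q; lia.
Qed.

(** The letters are recovered from left to right as partial sums modulo [N]. *)
Lemma diff_word_inj (n N : nat) :
  injective (@diff_word n N).
Proof.
move=> y z eq_yz; apply/ffunP => -[i lt_in].
elim: i lt_in => [|i IHi] lt_in.
  rewrite (_ : Ordinal lt_in = ord0); last exact: val_inj.
  by rewrite -(diff_word0 y) -(diff_word0 z) eq_yz.
have lt_i : (i < n)%N by [].
have := diff_wordS y (Ordinal lt_i); have := diff_wordS z (Ordinal lt_i).
rewrite (_ : lift ord0 (Ordinal lt_i) = Ordinal lt_in); last exact: val_inj.
rewrite (_ : widen_ord _ _ = Ordinal (ltnW lt_in)); last exact: val_inj.
rewrite IHi eq_yz => -> eq_sum; apply: val_inj => /=.
have ltz := ltn_ord (z (Ordinal lt_in)).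
have lty := ltn_ord (y (Ordinal lt_in)).
have := congr1 (fun m => m %% N)%N eq_sum.
by rewrite ![(_ + _ * N)%N]addnC !modnMDl !modn_small.
Qed.

(** The differences telescope to the last letter, and each descent leaves one borrow [N]. As the
    last letter is below [N], the quotient by [N] counts the descents. *)
Lemma sum_diff_word (n N : nat) (y : {ffun 'I_n.+1 -> 'I_N}) :
  (\sum_k diff_word y k = y ord_max + word_descents y * N)%N.
Proof.
rewrite word_descentsE big_distrl /= big_ord_recl diff_word0.
have tele : (y ord0 + \sum_(i < n) y (lift ord0 i) =
             \sum_(i < n) y (widen_ord (leqnSn n) i) + y ord_max)%N.
  by transitivity (\sum_i y i)%N; [rewrite big_ord_recl | rewrite big_ord_recr].
have eqS : (\sum_(i < n) diff_word y (lift ord0 i) +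
        \sum_(i < n) y (widen_ord (leqnSn n) i) =
        \sum_(i < n) y (lift ord0 i) + \sum_(i < n)
          (y (lift ord0 i) < y (widen_ord (leqnSn n) i)) * N)%N.
  by rewrite -!big_split; apply: eq_bigr => i _; exact: diff_wordS.
apply/eqP; rewrite -(eqn_add2r (\sum_(i < n) y (widen_ord (leqnSn n) i))).
apply/eqP; rewrite -addnA eqS addnA tele -addnA addnC.
by congr (_ + _ + _)%N; apply: eq_bigr => i _.
Qed.

Lemma sum_carry_descents (n N : nat) (F : nat -> rat) :
  \sum_(Y : {ffun 'I_n -> 'I_N}) F ((\sum_k Y k) %/ N)%N =
  \sum_(Y : {ffun 'I_n -> 'I_N}) F (word_descents Y).
Proof.
case: n => [|n].
  apply: eq_bigr => Y _; rewrite big_ord0 div0n /word_descents.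
  by rewrite (_ : [set i | _] = set0) ?cards0 //; apply/setP => -[].
rewrite (reindex_inj (@diff_word_inj n N)) /=; apply: eq_bigr => Y _.
rewrite sum_diff_word divnDMl ?divn_small //.
by case: (N) (Y ord0) => // -[].
Qed.

(** Standardization: a position is sent to the rank of its letter. *)
Lemma rank_perm (n N : nat) (y : {ffun 'I_n -> 'I_N}) : injective y ->
  exists s : {perm 'I_n}, forall i j, (s i < s j)%N = (y i < y j)%N.
Proof.
move=> y_inj; pose R i := #|[set l | (y l < y i)%N]|.
have ltR i : (R i < n)%N.
  rewrite -[X in (_ < X)%N]card_ord -cardsT; apply: proper_card.
  by apply/properP; split; [apply: subsetT | exists i; rewrite ?inE ?ltnn].
have monoR i j : (y i < y j)%N -> (R i < R j)%N.
  move=> lt_ij; apply: proper_card; apply/properP; split.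
    by apply/subsetP => l; rewrite !inE => /ltn_trans; apply.
  by exists i; rewrite !inE ?ltnn.
have R_inj : injective (fun i => Ordinal (ltR i)).
  move=> i j /(congr1 val) /= eqR; apply/y_inj/val_inj/eqP.
  by case: ltngtP => // /monoR; rewrite eqR ltnn.
exists (perm R_inj) => i j; rewrite !permE /=.
case: (ltngtP (y i) (y j)) => [/monoR //|/monoR /ltnW|/val_inj/y_inj ->].
  by rewrite leqNgt => /negbTE.
by rewrite ltnn.
Qed.

Lemma injective_word_descents (n N j : nat) :
  (n`! * #|[set y : {ffun 'I_n -> 'I_N} |
            injectiveb y && (word_descents y == j)]| = N ^_ n * eulerian n j)%N.
Proof.
pose act (y : {ffun 'I_n -> 'I_N}) (t : {perm 'I_n}) := [ffun i => y (t i)].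
have actK t : cancel (act^~ t) (act^~ (t^-1)%g).
  by move=> y; apply/ffunP => i; rewrite !ffunE permKV.
have act_inj t y : injectiveb (act y t) = injectiveb y.
  apply/injectiveP/injectiveP => y_inj i k.
    move=> eq_ik; apply: (perm_inj (s := (t^-1)%g)); apply: y_inj.
    by rewrite !ffunE !permKV.
  by rewrite !ffunE => /y_inj /perm_inj.
(* Double count the pairs (y, t) such that y o t has j descents. *)
transitivity (\sum_(t : {perm 'I_n})
    \sum_(y : {ffun 'I_n -> 'I_N} | injectiveb y)
      (word_descents (act y t) == j))%N.
  rewrite -(card_Sn n) -sum_nat_const; apply: eq_bigr => t _.
  rewrite (reindex_inj (can_inj (actK (t^-1)%g))) /=.
  under eq_bigl => y do rewrite act_inj.
  rewrite -sum1_card -big_mkcondr; apply: eq_bigl => y.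
  by rewrite !inE -{2}[t]invgK actK.
have -> : (N ^_ n = #|[set y : {ffun 'I_n -> 'I_N} | injectiveb y]|)%N.
  by rewrite card_inj_ffuns !card_ord.
rewrite exchange_big /= -sum_nat_const.
apply: eq_big => [y|y]; first by rewrite inE.
move=> /injectiveP /rank_perm [s s_mono].
(* [s] replaces the letters of [y] by their ranks; as [t] runs over all permutations, so does
   [t * s]. *)
rewrite /eulerian -sum1_card [RHS]big_mkcond [RHS](reindex_inj (mulIg s)) /=.
apply: eq_bigr => t _; rewrite inE.
rewrite (_ : word_descents _ = descents (t * s)%g); first by case: (_ == j).
apply: eq_card => i; rewrite !inE !ffunE !permM.
by case: ltnP => //= _; rewrite s_mono.
Qed.

Lemma ffact_le_expn (n N : nat) : (N ^_ n <= N ^ n)%N.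
Proof.
by elim: n => // n IHn; rewrite ffactnSr expnSr leq_mul ?leq_subr.
Qed.

(** Divided by [N ^ n.+1], this is a crude birthday bound: a word has a repeated letter with
    probability at most [n ^ 2 / N]. *)
Lemma expn_le_ffact (n N : nat) :
  (N ^ n.+1 <= N * N ^_ n + n ^ 2 * N ^ n)%N.
Proof.
elim: n => [|n IHn]; first by rewrite expn1 ffactn0 muln1 leq_addr.
rewrite ffactnSr !(expnSr _ n.+1) !(expnSr N n) in IHn *.
have := ffact_le_expn n N; move: (N ^_ n) (N ^ n)%N IHn => A B IHn le_AB.
have [le_nN|lt_Nn] := leqP n N; last by nia.
have IHN := leq_mul IHn (leqnn N); have le_nAB := leq_mul le_AB (leqnn (n * N)).
have eqN : (N * (A * (N - n)) + A * (n * N) = N * A * N)%N.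
  rewrite (_ : A * (n * N) = N * (A * n))%N; last by ring.
  by rewrite -!mulnDr subnK // mulnA.
rewrite mulnDl in IHN.
rewrite (_ : n.+1 ^ 2 = n ^ 2 + 2 * n + 1)%N; last by nia.
by rewrite !mulnDl -!mulnA in IHN eqN le_nAB *; lia.
Qed.

Lemma word_descents_approx (n N j : nat) : (0 < N)%N ->
  `|(#|[set y : {ffun 'I_n -> 'I_N} | word_descents y == j]|)%:R / (N ^ n)%:R
    - (eulerian n j)%:R / n`!%:R| <= (n ^ 2)%:R / N%:R :> rat.
Proof.
move=> N_gt0; set W := [set y | _]; pose inj : {set {ffun 'I_n -> 'I_N}} :=
  [set y : {ffun 'I_n -> 'I_N} | injectiveb y].
have := injective_word_descents n N j.
rewrite (_ : [set y : {ffun _ -> _} | injectiveb y & _] = inj :&: W);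
  last by apply/setP => y; rewrite !inE.
have card_inj : #|inj| = (N ^_ n)%N by rewrite card_inj_ffuns !card_ord.
have := cardsID inj W; rewrite [W :&: inj]setIC.
have : (#|W :\: inj| + #|inj| <= N ^ n)%N.
  have := cardsC inj; rewrite card_ffun !card_ord => <-.
  by rewrite addnC leq_add2l subset_leq_card // setDE subsetIr.
have := expn_le_ffact n N; rewrite card_inj.
have le_eul : (eulerian n j <= n`!)%N by rewrite -(card_Sn n) max_card.
(* [I] and [D] count the words with [j] descents, without and with repetition; below, [A] and [B]
   count the words without repetition and all words. *)
move: #|_ :&: _| #|_ :\: _| #|W| => I D w.
move: (eulerian n j) le_eul (fact_gt0 n) => e; move: n`! => f.
have := ffact_le_expn n N; rewrite expnSr; move: (N ^_ n) => A.
have := expn_gt0 N n; rewrite N_gt0 /=; move: (N ^ n)%N => B.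
move=> B_gt0 le_AB le_ef f_gt0 le_N le_D w_eq fI_eq.
have posr m : (0 < m)%N -> 0 < m%:R :> rat by rewrite ltr0n.
have [N0 B0 f0] := And3 (posr _ N_gt0) (posr _ B_gt0) (posr _ f_gt0).
move: le_AB le_ef le_N le_D; rewrite -!(ler_nat rat) !natrD !natrM.
move=> le_AB le_ef le_N le_D.
have {fI_eq} : f%:R * I%:R = A%:R * e%:R :> rat by rewrite -!natrM fI_eq.
rewrite -w_eq natrD => fI_eq.
have eE : e%:R = (e%:R / f%:R) * f%:R :> rat by rewrite divfK ?gt_eqF.
set q := e%:R / f%:R in eE *.
have q0 : 0 <= q by rewrite divr_ge0 ?ler0n.
have q1 : q <= 1 by rewrite ler_pdivrMr // mul1r.
have IE : I%:R = A%:R * q :> rat.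
  by apply: (mulfI (lt0r_neq0 f0)); rewrite fI_eq eE; ring.
have D0 : 0 <= D%:R :> rat by rewrite ler0n.
rewrite IE -(ler_pM2r B0) -[X in _ * X](gtr0_norm B0) -normrM.
rewrite mulrBl divfK ?gt_eqF // [X in _ <= X]mulrAC ler_pdivlMr //.
(* The quantity is [D - q * (B - A)], a difference of two terms between 0 and [B - A]. *)
have le_BA : `|A%:R * q + D%:R - q * B%:R| <= B%:R - A%:R :> rat.
  have q_le : q * (B%:R - A%:R) <= B%:R - A%:R :> rat.
    by rewrite ler_piMl //; lra.
  have q_ge : 0 <= q * (B%:R - A%:R) :> rat by rewrite mulr_ge0 //; lra.
  by rewrite ler_norml; apply/andP; split; lra.
by apply: le_trans (ler_wpM2r (ltW N0) le_BA) _; lra.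
Qed.

(** * Comparison of the carry laws in bases [a] and [K * a] *)

Definition carry_prob (a n j : nat) : rat :=
  (\sum_(Y : {ffun 'I_n -> 'I_a}) ((\sum_k Y k) %/ a == j)%N%:R) / (a ^ n)%:R.

Lemma sum_eq_ord_le1 (L x : nat) : \sum_(j < L) (x == j)%:R <= 1 :> rat.
Proof.
have [lt_xL|le_Lx] := ltnP x L; last first.
  rewrite big1 ?ler01 // => j _; case: eqP => // eq_xj.
  by have := ltn_ord j; lia.
rewrite (bigD1 (Ordinal lt_xL)) //= eqxx big1 ?addr0 // => j.
by rewrite -val_eqE /= eq_sym => /negbTE ->.
Qed.

(** Summation by parts moves the shift from [F] to the counts; the range has room for the largest
    shifted sum. *)
Lemma sum_box_shift (a n : nat) (F : nat -> rat) :
  \sum_(v : {ffun 'I_n -> 'I_a}) F (\sum_k v k)%N -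
  \sum_(v : {ffun 'I_n -> 'I_a}) F (\sum_k v k).+1%N =
  \sum_(s < (n * a.-1).+2)
    (box_count a n s%:Z - box_count a n (s%:Z - 1)) * F s.
Proof.
pose S (v : {ffun 'I_n -> 'I_a}) := (\sum_k v k)%N.
have boundS v : (S v < (n * a.-1).+1)%N by apply: sum_ord_lt.
rewrite (@sum_coef_genfun _ _ S F (n * a.-1).+2) => [|v]; last exact: leqW.
rewrite (@sum_coef_genfun _ _ S (fun s => F s.+1) (n * a.-1).+1) // !genfun_box.
under [RHS]eq_bigr => s _ do rewrite mulrBl.
rewrite sumrB; congr (_ - _).
rewrite [RHS]big_ord_recl box_countN // mul0r add0r.
apply: eq_bigr => s _; rewrite lift0.
by rewrite (_ : s.+1%:Z - 1 = s%:Z); last by lia.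
Qed.

(** Raising the incoming carry by one shifts the digit sum by one, and grouping the sums by quotient
    cannot increase the l1 distance. *)
Lemma carry_shift1 (a n i L : nat) (c : rat) : (0 < a)%N ->
  (forall s, box_count a n s <= c) ->
  \sum_(j < L)
    `|\sum_(v : {ffun 'I_n -> 'I_a}) ((i + \sum_k v k) %/ a == j)%N%:R -
      \sum_(v : {ffun 'I_n -> 'I_a}) ((i.+1 + \sum_k v k) %/ a == j)%N%:R|
    <= c *+ 2.
Proof.
move=> a_gt0 le_c; set d := fun s : nat =>
  box_count a n s%:Z - box_count a n (s%:Z - 1).
pose B := (n * a.-1).+2.
have le_d : \sum_(s < B) `|d s| <= c *+ 2.
  apply: (@sum_dist_sym_unimodal (n * a.-1)%N (box_count a n)) => [|s|].
  - exact: sym_unimodal_box.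
  - by rewrite box_count_ge0 le_c.
  - exact: box_countN.
apply: le_trans le_d; apply: (@le_trans _ _
  (\sum_(j < L) \sum_(s < B) `|d s| * ((i + s) %/ a == j)%N%:R)).
  apply: ler_sum => j _.
  under [X in _ - X]eq_bigr => v _ do rewrite addSnnS.
  rewrite (sum_box_shift a n (fun s => ((i + s) %/ a == j)%N%:R)).
  apply: le_trans (ler_norm_sum _ _ _) _; apply: ler_sum => s _.
  by rewrite normrM [X in _ * X]ger0_norm ?ler0n.
rewrite exchange_big /=; apply: ler_sum => s _.
by rewrite -mulr_sumr ler_piMr // sum_eq_ord_le1.
Qed.

Lemma carry_shift (a n m L : nat) (c : rat) : (0 < a)%N ->
  (forall s, box_count a n s <= c) ->
  \sum_(j < L)
    `|\sum_(v : {ffun 'I_n -> 'I_a}) ((\sum_k v k) %/ a == j)%N%:R -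
      \sum_(v : {ffun 'I_n -> 'I_a}) ((m + \sum_k v k) %/ a == j)%N%:R|
    <= c *+ 2 * m%:R.
Proof.
move=> a_gt0 le_c; elim: m => [|m IHm].
  by rewrite mulr0 big1 // => j _; rewrite subrr normr0.
rewrite -[m.+1]addn1 natrD mulrDr mulr1 addn1.
apply: le_trans (lerD IHm (carry_shift1 m L a_gt0 le_c)).
by rewrite -big_split; apply: ler_sum => j _; apply: ler_distD.
Qed.

Lemma carry_prob_mul (a K n j : nat) : (0 < K)%N ->
  carry_prob (K * a) n j =
  (\sum_(u : {ffun 'I_n -> 'I_K}) \sum_(v : {ffun 'I_n -> 'I_a})
    (((\sum_k u k) %/ K + \sum_k v k) %/ a == j)%N%:R)
  / ((K ^ n)%:R * (a ^ n)%:R).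
Proof.
move=> K_gt0; rewrite /carry_prob expnMn natrM; congr (_ / _).
rewrite (sum_box_mul _ _ _ (fun s => (s %/ (K * a) == j)%N%:R)).
apply: eq_bigr => u _; apply: eq_bigr => v _.
by rewrite divnMA addnC mulnC divnMDl // addnC.
Qed.

Lemma mean_carry_le (K n : nat) : (0 < n)%N ->
  (\sum_(u : {ffun 'I_n -> 'I_K}) ((\sum_k u k) %/ K)%N%:R) *+ 2
  <= n.-1%:R * (K ^ n)%:R :> rat.
Proof.
move=> n_gt0.
pose rev (u : {ffun 'I_n -> 'I_K}) := [ffun k => rev_ord (u k)].
have revK : involutive rev.
  by move=> u; apply/ffunP => k; rewrite !ffunE rev_ordK.
(* Complementing every digit sends the sum S to n(K-1) - S, and the two carries
   add up to at most n-1. *)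
rewrite mulr2n [X in X + _](reindex_inj (inv_inj revK)) -big_split /=.
have -> : n.-1%:R * (K ^ n)%:R =
    \sum_(u : {ffun 'I_n -> 'I_K}) n.-1%:R :> rat.
  by rewrite sumr_const card_ffun !card_ord mulr_natr.
apply: ler_sum => u _; rewrite -natrD ler_nat.
have K_gt0 : (0 < K)%N by have := ltn_ord (u (Ordinal n_gt0)); lia.
apply: (@leq_trans ((\sum_k rev u k + \sum_k u k) %/ K)%N).
  by rewrite divnD // leq_addr.
rewrite -ltnS prednK // ltn_divLR // -big_split /=.
rewrite -[X in (_ < X * _)%N]card_ord -sum_nat_const.
rewrite -[X in (X < _)%N]addn0.
have -> : (\sum_(i in 'I_n) K = \sum_(k < n) (rev u k + u k) + n)%N.
  rewrite -[X in (_ + X)%N]card_ord -sum1_card -big_split /=.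
  apply: eq_bigr => k _; rewrite ffunE /=.
  by have := ltn_ord (u k); lia.
by rewrite ltn_add2l.
Qed.

(** Given the low digits, [carry_shift] costs [2 * c] times their carry, whose mean is at most
    [(n - 1) / 2]. The bound is free of [K], as the limit requires. *)
Lemma carry_prob_dist (a K n L : nat) (c : rat) :
  (0 < a)%N -> (0 < K)%N -> (0 < n)%N -> (forall s, box_count a n s <= c) ->
  \sum_(j < L) `|carry_prob a n j - carry_prob (K * a) n j|
  <= n.-1%:R * c / (a ^ n)%:R.
Proof.
move=> a_gt0 K_gt0 n_gt0 le_c.
have A0 : 0 < (a ^ n)%:R :> rat by rewrite ltr0n expn_gt0 a_gt0.
have K0 : 0 < (K ^ n)%:R :> rat by rewrite ltr0n expn_gt0 K_gt0.
pose h (m j : nat) : rat :=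
  \sum_(v : {ffun 'I_n -> 'I_a}) ((m + \sum_k v k) %/ a == j)%N%:R.
pose m (u : {ffun 'I_n -> 'I_K}) := ((\sum_k u k) %/ K)%N.
have distE (j : nat) : carry_prob a n j - carry_prob (K * a) n j =
    (\sum_u (h 0%N j - h (m u) j)) / ((K ^ n)%:R * (a ^ n)%:R).
  rewrite carry_prob_mul // sumrB sumr_const card_ffun !card_ord /carry_prob.
  rewrite -/(h 0%N j) -mulr_natl mulrBl; congr (_ - _).
  by field; rewrite !gt_eqF.
apply: (@le_trans _ _ ((\sum_(j < L) \sum_u `|h 0%N j - h (m u) j|) /
  ((K ^ n)%:R * (a ^ n)%:R))).
  rewrite mulr_suml; apply: ler_sum => j _; rewrite distE normrM.
  rewrite [X in _ * X <= _]ger0_norm ?invr_ge0 ?mulr_ge0 ?ler0n //.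
  by rewrite ler_pM2r ?invr_gt0 ?mulr_gt0 // ler_norm_sum.
rewrite exchange_big /= ler_pdivrMr ?mulr_gt0 //.
apply: (@le_trans _ _ (\sum_u c *+ 2 * (m u)%:R)).
  by apply: ler_sum => u _; apply: (carry_shift (m u) L a_gt0 le_c).
have c0 : 0 <= c by apply: le_trans (le_c 0); apply: box_count_ge0.
have := ler_wpM2l c0 (mean_carry_le K n_gt0).
rewrite -mulr_sumr -/m => le_mean.
rewrite [X in _ <= X](_ : _ = c * (n.-1%:R * (K ^ n)%:R)); last first.
  by field; rewrite gt_eqF.
by apply: le_trans le_mean; rewrite mulrnAr mulrnAl.
Qed.

(** * The Eulerian law as a limit, and the l1 bounds *)

Lemma sum_natr_eq (T : finType) (phi : T -> nat) (j : nat) :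
  \sum_x (phi x == j)%:R = (#|[set x | phi x == j]|)%:R :> rat.
Proof.
rewrite -natr_sum -sum1_card [in RHS]big_mkcond; congr _%:R.
by apply: eq_bigr => x _; rewrite inE; case: eqP.
Qed.

Lemma carry_prob_count (b n r j : nat) : (0 < b)%N ->
  carry_prob (b ^ r) n j =
  (carries_count b n r j)%:R / (b ^ (r * n))%:R.
Proof.
move=> b_gt0; rewrite /carry_prob expnM; congr (_ / _).
rewrite -(sum_carry_after n r (fun m => (m == j)%:R) b_gt0).
by rewrite sum_natr_eq.
Qed.

Definition eulerian_prob (n j : nat) : rat := (eulerian n j)%:R / n`!%:R.

Lemma carry_prob_eulerian (n N j : nat) : (0 < N)%N ->
  `|carry_prob N n j - eulerian_prob n j| <= (n ^ 2)%:R / N%:R.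
Proof.
move=> N_gt0; apply: le_trans (word_descents_approx n j N_gt0).
rewrite /carry_prob (sum_carry_descents n N (fun m => (m == j)%:R)).
by rewrite sum_natr_eq.
Qed.

Definition l1_dist (n : nat) (P Q : nat -> rat) : rat :=
  \sum_(j < n) `|P j - Q j|.

(** The [n] errors of at most [n ^ 2 / (K * a)] add up to at most [n ^ 3 / K], which falls below any
    gap [d - D] for large [K]. *)
Lemma l1_dist_eulerian (a n : nat) (D : rat) : (0 < a)%N ->
  (forall K, (0 < K)%N ->
     l1_dist n (carry_prob a n) (carry_prob (K * a) n) <= D) ->
  l1_dist n (carry_prob a n) (eulerian_prob n) <= D.
Proof.
move=> a_gt0 le_D; set d := l1_dist _ _ _.
have le_d K : (0 < K)%N -> d <= D + (n ^ 3)%:R / K%:R.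
  move=> K_gt0; apply: (@le_trans _ _ (l1_dist n (carry_prob a n)
    (carry_prob (K * a) n) +
    l1_dist n (carry_prob (K * a) n) (eulerian_prob n))).
    by rewrite -big_split; apply: ler_sum => j _; apply: ler_distD.
  apply: lerD; first exact: le_D.
  have Ka_gt0 : (0 < K * a)%N by rewrite muln_gt0 K_gt0.
  apply: (@le_trans _ _ (\sum_(j < n) (n ^ 2)%:R / (K * a)%:R)).
    by apply: ler_sum => j _; apply: carry_prob_eulerian.
  rewrite sumr_const card_ord -[X in X <= _]mulr_natl mulrA -natrM -expnS.
  rewrite ler_wpM2l ?ler0n // lef_pV2 ?posrE ?ltr0n // ler_nat.
  exact: leq_pmulr.
rewrite leNgt; apply/negP => lt_Dd.
have dD0 : 0 < d - D by rewrite subr_gt0.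
pose K := Num.truncn ((n ^ 3)%:R / (d - D)).
have := le_d K.+1 isT; rewrite leNgt => /negP; apply.
rewrite -ltrBrDl ltr_pdivrMr ?ltr0n // mulrC -ltr_pdivrMr //.
by apply: truncnS_gt.
Qed.

Lemma carry_prob_ge0 (a n j : nat) : 0 <= carry_prob a n j.
Proof. by rewrite divr_ge0 ?ler0n ?sumr_ge0. Qed.

Lemma sum_carry_prob_le1 (a n L : nat) : (0 < a)%N ->
  \sum_(j < L) carry_prob a n j <= 1.
Proof.
move=> a_gt0; rewrite -mulr_suml ler_pdivrMr ?ltr0n ?expn_gt0 ?a_gt0 // mul1r.
rewrite exchange_big /=.
apply: le_trans (ler_sum _ (fun Y _ => sum_eq_ord_le1 L _)) _.
by rewrite sumr_const card_ffun !card_ord.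
Qed.

(** Two carry laws, each of mass at most 1, are at distance at most 2, and this passes to the
    limit. *)
Lemma l1_dist_carry_le2 (a n : nat) : (0 < a)%N ->
  l1_dist n (carry_prob a n) (eulerian_prob n) <= 2.
Proof.
move=> a_gt0; apply: l1_dist_eulerian => // K K_gt0.
have Ka_gt0 : (0 < K * a)%N by rewrite muln_gt0 K_gt0.
apply: le_trans (lerD (sum_carry_prob_le1 n n a_gt0)
                      (sum_carry_prob_le1 n n Ka_gt0)).
rewrite -big_split; apply: ler_sum => j _ /=.
apply: le_trans (ler_normB _ _) _.
by rewrite !ger0_norm ?carry_prob_ge0.
Qed.

Lemma l1_dist_carry_le (a n : nat) : (0 < a)%N -> (0 < n)%N ->
  l1_dist n (carry_prob a n) (eulerian_prob n) <= n.-1%:R / a%:R.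
Proof.
move=> a_gt0 n_gt0; apply: l1_dist_eulerian => // K K_gt0.
case: n n_gt0 => // n _.
apply: le_trans (carry_prob_dist n.+1 a_gt0 K_gt0 (ltn0Sn n)
  (@box_count_le a n)) _.
have a0 : a%:R != 0 :> rat by rewrite pnatr_eq0 -lt0n.
have A0 : (a ^ n)%:R != 0 :> rat by rewrite pnatr_eq0 -lt0n expn_gt0 a_gt0.
rewrite expnSr natrM [X in X <= _](_ : _ = n.+1.-1%:R / a%:R) //.
by field; rewrite a0 A0.
Qed.

Lemma l1_dist_carry_le4 (a n : nat) : (0 < a)%N -> (4 <= n)%N ->
  l1_dist n (carry_prob a n) (eulerian_prob n) <=
  n.-1%:R * (2 * a ^ 2 + 1)%:R / (3 * a ^ 3)%:R.
Proof.
move=> a_gt0 le4n; apply: l1_dist_eulerian => // K K_gt0.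
apply: le_trans (carry_prob_dist n a_gt0 K_gt0 (leq_trans _ le4n)
  (fun s => box_count_le4 s a_gt0 le4n)) _ => //.
have a0 : a%:R != 0 :> rat by rewrite pnatr_eq0 -lt0n.
have A0 : (a ^ (n - 4))%:R != 0 :> rat.
  by rewrite pnatr_eq0 -lt0n expn_gt0 a_gt0.
have -> : (a ^ n)%:R = (a ^ (n - 4))%:R * a%:R ^+ 4 :> rat.
  by rewrite -natrX -natrM -expnD subnK.
rewrite natrM; move: A0; move: (a ^ (n - 4))%:R => A A0.
have -> : (2 * a ^ 3 + a)%:R = 2 * a%:R ^+ 3 + a%:R :> rat.
  by rewrite natrD natrM natrX.
have -> : (2 * a ^ 2 + 1)%:R = 2 * a%:R ^+ 2 + 1 :> rat.
  by rewrite natrD natrM natrX.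
have -> : (3 * a ^ 3)%:R = 3 * a%:R ^+ 3 :> rat by rewrite natrM natrX.
move: a%:R a0 => x x0.
rewrite [X in X <= _](_ : _ = n.-1%:R * (2 * x ^+ 2 + 1) / (3 * x ^+ 3)) //.
by field; rewrite x0 A0.
Qed.

(** * Transfer from [rat] to the reals, and conclusion *)

Lemma RsumE (f : nat -> R) (m : nat) : Rsum f m = \sum_(j < m) f j.
Proof.
by elim: m => [|m IHm]; rewrite ?big_ord0 // big_ord_recr /= IHm.
Qed.

Lemma tv_distE (b n r : nat) : (0 < b)%N ->
  tv_dist n (carries_dist b n r) (carries_stat n) =
  Rmult (Rinv (IZR 2))
    (ratr (l1_dist n (carry_prob (b ^ r) n) (eulerian_prob n))).
Proof.
move=> b_gt0; rewrite /tv_dist RsumE /l1_dist rmorph_sum /=; congr (Rmult _ _).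
apply: eq_bigr => j _; rewrite RabsE RminusE ratr_norm rmorphB /=.
rewrite carry_prob_count // /carries_dist /carries_stat !RdivE !INRE.
by rewrite !fmorph_div /= !ratr_nat.
Qed.

Open Scope R_scope.

(* r is the ceiling of log_b(c n) = ln(c n)/ln b; the chain is run for
   Z.to_nat r steps (r <= 0 happens only when c n <= 1, then 0 steps). *)
Theorem theorem3p1 (n b : nat) (c : R) (r : Z)
  (hn : (2 <= n)%N) (hb : (2 <= b)%N) (hc : (0 < c))
  (hr : (IZR r - 1 < ln (c * INR n) / ln (INR b) <= IZR r)) :
  (tv_dist n (carries_dist b n (Z.to_nat r)) (carries_stat n)
     <= / 2 * sqrt (exp (/ (2 * c ^ 2)) - 1)).
Proof.
have b_gt0 : (0 < b)%N := ltnW hb.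
rewrite tv_distE //; set a := (b ^ _)%N; set d := l1_dist _ _ _.
have a_gt0 : (0 < a)%N by rewrite expn_gt0 b_gt0.
have n0 : 0 < INR n by apply: lt_0_INR; lia.
have le_a : c * INR n <= INR a.
  have -> : INR a = INR b ^ Z.to_nat r by rewrite !INRE natrX RpowE.
  case: hr => _; apply: ceil_log_pow => //.
  exact: Rmult_lt_0_compat.
(* From here on, [a] is any positive integer with [c * n <= a]. *)
clearbody a; have nE : (n.-1%:R)%R = INR n - 1.
  by rewrite INRE RminusE R1E -[in RHS](prednK (ltnW hn)) -addn1 natrD addrK.
have a0 : (0 < a%:R :> rat)%R by rewrite ltr0n.
apply: (tv_exp_bound hn hc le_a); apply: exp_quadratic_bound => //.
- by apply/RleP; rewrite ler0q sumr_ge0.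
- have -> : 2 = ratr 2%:R by rewrite ratr_nat -INRE.
  by apply/RleP; rewrite ler_rat l1_dist_carry_le2.
- have := l1_dist_carry_le a_gt0 (ltnW hn).
  rewrite -/d ler_pdivlMr // -(ler_rat R) rmorphM /= !ratr_nat nE -INRE.
  by move/RleP.
- move=> n4; have := l1_dist_carry_le4 a_gt0 n4.
  rewrite -/d ler_pdivlMr ?ltr0n ?muln_gt0 ?expn_gt0 ?a_gt0 //.
  rewrite -(ler_rat R) !rmorphM /= !ratr_nat natrM natrD natrM !natrX nE.
  rewrite -!INRE -!RpowE.
  by rewrite (INR_IZR_INZ 1) (INR_IZR_INZ 2) (INR_IZR_INZ 3) => /RleP.
Qed.
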